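(* Let $k\ge 2$ be a fixed integer and let $G$ be a graph containing no $2k$-cycle. For any vertex subsets $A,B\subseteq V(G)$, not necessarily disjoint, \[ e(A,B)\le O\!\left(|A|+|B|+(|A||B|)^{(k+1)/(2k)}\right), \] where the implied constant depends only on $k$.
   Context: $e(A,B)$ denotes the number of edges of $G$ with one endpoint in $A$ and the other endpoint in $B$ (i.e. $|E\cap(A\times B)|$). *)

(* Defs.v *)
From mathcomp Require Import all_boot.

Set Implicit Arguments.
Unset Strict Implicit.
Unset Printing Implicit Defensive.

Record sgraph := SGraph {
  vertex :> finType;
  adj : rel vertex;
  adj_sym : symmetric adj;
  adj_irrefl : irreflexive adj }.

(* A copy of C_n as a (not necessarily induced) subgraph; for n <= 2 the
   predicate [ucycle] is degenerate, so this is meant for n >= 3. *)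
Definition has_cycle (G : sgraph) (n : nat) : Prop :=
  exists c : seq G, size c = n /\ ucycle (@adj G) c.

(* |E ∩ (A × B)| with E the symmetric adjacency relation: an edge with both
   endpoints in A ∩ B contributes two ordered pairs. *)
Definition edges_between (G : sgraph) (A B : {set G}) : nat :=
  #|[set p in setX A B | adj p.1 p.2]|.

(* Main.v *)
(* Passing to a random cut and then to a core, one may assume that the graph is
   bipartite and that the degrees on the two sides exceed constant fractions tA,
   tB of the average degrees e/|A|, e/|B|.  Let V_i be the distance layers around
   a root.  If G has no 2k-cycle, then e(V_i, V_{i+1}) = O(|V_i| + |V_{i+1}|) for
   i < k, so that |V_{i+1}| is at least of order tA |V_i| or tB |V_i|, according
   to the side of V_i.  Multiplying the resulting lower bounds on |V_k| for a
   root in A and a root in B gives (tA tB)^k = O(|A| |B|), which is the claim.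

   For the layer bound, fix a tree of shortest paths to the root.  Every v in
   V_{i+1} keeps, after losing O(k^2) of its neighbours in V_i, a set N'(v) having
   a common ancestor at some height j(v), while at height j(v) - 1 no ancestor is
   shared by all but fewer than 2k elements of N'(v).  If for some j the edges
   kept by the v with j(v) = j are too many, then they contain, by a greedy
   argument, a path of length 2(k - j) - 1 from some v to some x in V_i.  All its
   vertices in V_i have the same ancestor at height j, and v has a neighbour x'
   off the path whose ancestor at height j - 1 differs from that of x.  The path,
   the edge vx' and the two tree paths of length j form a 2k-cycle. *)
Require Import Defs.
From mathcomp Require Import all_boot all_order all_algebra.
From mathcomp Require Import reals exp zify.

Set Implicit Arguments.
Unset Strict Implicit.
Unset Printing Implicit Defensive.

(** * Dense cores and greedy paths *)

Lemma ex_notin_seq (T : finType) (A : {set T}) (s : seq T) :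
  size s < #|A| -> exists2 u, u \in A & u \notin s.
Proof.
move=> ltsA; case: (boolP [exists u in A, u \notin s]) => [/exists_inP//|].
rewrite negb_exists_in => /forall_inP inA.
have: #|A| <= size s.
  apply: leq_trans (card_size s); apply/subset_leq_card/subsetP => u uA.
  by have := inA u uA; rewrite negbK.
by rewrite leqNgt ltsA.
Qed.

Section Core.
Variables (T : finType) (r : rel T).
Hypothesis r_sym : symmetric r.

Definition deg_in (S : {set T}) (v : T) : nat := #|[set u in S | r v u]|.

Lemma deg_inE S v : deg_in S v = \sum_(u in S) r v u.
Proof.
rewrite /deg_in -sum1_card big_mkcond [RHS]big_mkcond /=.
by apply: eq_bigr => u _; rewrite inE; case: (u \in S) => //=; case: (r v u).
Qed.

Lemma deg_inS (S S' : {set T}) v : S \subset S' -> deg_in S v <= deg_in S' v.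
Proof.
move=> sSS'; apply/subset_leq_card/subsetP => u; rewrite !inE => /andP[uS ->].
by rewrite (subsetP sSS').
Qed.

(** Delete, one at a time, a vertex [v] of degree at most [t v]. This lowers the degree sum by at
    most [2 * t v], so the strict inequality survives and [S] is never exhausted. The threshold
    depends on the vertex because the two sides of a bipartite graph will need different ones. *)
Lemma core_exists (t : T -> nat) (S : {set T}) :
  2 * \sum_(v in S) t v < \sum_(v in S) deg_in S v ->
  exists S' : {set T}, [/\ S' \subset S, S' != set0 &
    forall v, v \in S' -> t v < deg_in S' v].
Proof.
have [n] := ubnP #|S|; elim: n S => // n IHn S leSn dense.
have [/existsP[v /andP[vS dv]]|/existsPn core] :=
    boolP [exists v, (v \in S) && (deg_in S v <= t v)]; last first.
  exists S; split=> //.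
    by apply: contraTneq dense => ->; rewrite !big_set0.
  by move=> v vS; have := core v; rewrite vS /= ltnNge.
have [||S' [sS' S'0 core]] := IHn (S :\ v).
- by move: leSn; rewrite (cardsD1 v S) vS.
- have eS : \sum_(u in S) deg_in S u
      <= 2 * deg_in S v + \sum_(u in S :\ v) deg_in (S :\ v) u.
    rewrite (big_setD1 v) //= mul2n -addnn -addnA leq_add2l.
    have -> : \sum_(u in S :\ v) deg_in S u =
              \sum_(u in S :\ v) (r v u + deg_in (S :\ v) u).
      apply: eq_bigr => u _; rewrite !deg_inE (big_setD1 v vS) /=.
      by rewrite r_sym.
    rewrite big_split /= leq_add2r -deg_inE; apply: deg_inS; exact: subD1set.
  by move: dense; rewrite (big_setD1 v vS) /=; lia.
exists S'; split=> //; exact: subset_trans sS' (subD1set _ _).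
Qed.

(** Before each extension at most [m] vertices are in use, fewer than the endpoint has neighbours in
    [S]. *)
Lemma greedy_path (S : {set T}) m n v :
  (forall u, u \in S -> m < deg_in S u) -> n <= m -> v \in S ->
  exists q, [/\ size q = n, path r v q, uniq (v :: q) & {subset q <= S}].
Proof.
move=> core; elim: n => [|n IHn] lenm vS; first by exists [::].
have [q [szq pq uq qS]] := IHn (ltnW lenm) vS.
have lS : last v q \in S.
  by have := mem_last v q; rewrite inE => /predU1P[->//|/qS].
have [|u] := @ex_notin_seq _ [set u in S | r (last v q) u] (v :: q).
- apply: leq_trans (core _ lS); rewrite /= szq; exact: lenm.
- rewrite inE => /andP[uS ru] unq; exists (rcons q u).
  rewrite size_rcons szq rcons_path pq ru -rcons_cons rcons_uniq unq uq.
  by split=> // w; rewrite mem_rcons inE => /predU1P[->//|/qS].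
Qed.

End Core.

(** * Distance layers around a root, and common ancestors *)

Section Distance.
Variables (T : finType) (r : rel T) (x : T) (K : nat).

Fixpoint ball (i : nat) : {set T} :=
  if i is i'.+1 then ball i' :|: [set v | [exists u in ball i', r u v]]
  else [set x].

(* The distance from [x], truncated at [K]. *)
Definition tdist (v : T) : nat := find (fun i => v \in ball i) (iota 0 K).

Lemma ball_leq i j : i <= j -> ball i \subset ball j.
Proof.
elim: j => [|j IHj]; first by rewrite leqn0 => /eqP->.
rewrite leq_eqVlt => /predU1P[->//|]; rewrite ltnS => /IHj/subset_trans.
by apply; rewrite /= subsetUl.
Qed.

Lemma tdist_leq v : tdist v <= K.
Proof. by rewrite -[leqRHS](size_iota 0) find_size. Qed.

Lemma tdist_ball v i : i < K -> (v \in ball i) = (tdist v <= i).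
Proof.
move=> ltiK; apply/idP/idP => [vi|levi].
  rewrite leqNgt; apply/negP => /(before_find 0).
  by rewrite nth_iota // add0n vi.
have ltvK := leq_ltn_trans levi ltiK.
have : has (fun j => v \in ball j) (iota 0 K) by rewrite has_find size_iota.
by move/(nth_find 0); rewrite nth_iota // add0n; apply/subsetP/ball_leq.
Qed.

Lemma tdist_root : tdist x = 0.
Proof.
case: (posnP K) => [K0|K0]; first by apply/eqP; rewrite -leqn0 -K0 tdist_leq.
by apply/eqP; rewrite -leqn0 -tdist_ball //= inE.
Qed.

Lemma tdist_eq0 v : 0 < K -> tdist v = 0 -> v = x.
Proof. by move=> K0 v0; apply/set1P; rewrite -[[set x]]/(ball 0) tdist_ball ?v0. Qed.

Lemma tdist_adj u v : r u v -> tdist v <= (tdist u).+1.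
Proof.
move=> ruv; have [lt|] := ltnP (tdist u).+1 K; last exact/leq_trans/tdist_leq.
rewrite -tdist_ball // inE; apply/orP; right; rewrite inE.
by apply/exists_inP; exists u; rewrite // tdist_ball // ltnW.
Qed.

Lemma tdist_parent v : 0 < tdist v < K ->
  exists2 u, r u v & tdist v = (tdist u).+1.
Proof.
case dv: (tdist v) => [|i] //= ltiK.
have : v \in ball i.+1 by rewrite tdist_ball ?dv.
rewrite /= !inE tdist_ball ?dv ?ltnn //=; last exact: ltnW.
case/exists_inP => u; rewrite tdist_ball; last exact: ltnW.
move=> leui ruv; exists u => //; apply/eqP; rewrite eqSS eqn_leq leui andbT.
by have := tdist_adj ruv; rewrite dv.
Qed.

End Distance.

(** Descend from [i]: while some [c] is the ancestor, one generation closer, of all but fewer than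
    [m] elements, keep only the elements below [c]. Each round loses fewer than [m] elements. The
    descent stops before 0, where a common ancestor would leave a single element. *)
Lemma spread_subset (T : finType) (p : T -> T) m i (N : {set T}) :
  {in N &, forall u u', iter i p u = iter i p u'} -> m * i + 1 < #|N| ->
  exists j (N' : {set T}), [/\ 0 < j <= i, N' \subset N, #|N| <= #|N'| + m * i,
    {in N' &, forall u u', iter j p u = iter j p u'} &
    forall c, m <= #|[set u in N' | iter j.-1 p u != c]|].
Proof.
elim: i N => [|i IHi] N cN.
  rewrite muln0 => /card_gt1P[u [u' [uN u'N]]].
  by rewrite [u](cN u u' uN u'N) eqxx.
move=> ltN; have [/forallP big|/forallPn[c]] :=
  boolP [forall c, m <= #|[set u in N | iter i p u != c]|].
  by exists i.+1, N; split; rewrite // ?leqnn ?leq_addr.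
rewrite -ltnNge => small.
pose N1 := [set u in N | iter i p u == c].
have cardN : #|N| = #|N1| + #|[set u in N | iter i p u != c]|.
  rewrite -(cardsID [set u | iter i p u == c] N); congr (_ + _).
    by apply: eq_card => u; rewrite !inE.
  by apply: eq_card => u; rewrite !inE andbC.
have sN1 : N1 \subset N by apply/subsetP => u; rewrite inE => /andP[].
have [u u'||j [N' [/andP[j0 ji] sN' leN cN' big]]] := IHi N1.
- by rewrite !inE => /andP[_ /eqP->] /andP[_ /eqP->].
- by move: ltN; rewrite cardN mulnS; lia.
exists j, N'; split=> //; first by rewrite j0 ltnW.
- exact: subset_trans sN1.
- by rewrite cardN mulnS; lia.
Qed.

(** * Edges between consecutive layers, for a height [h] with parent map [p] *)

Section LayerDensity.
Variables (T : finType) (r : rel T) (h : T -> nat) (p : T -> T) (k : nat).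
Hypothesis r_sym : symmetric r.
Hypothesis parentP : forall v, 0 < h v <= k -> r (p v) v /\ h v = (h (p v)).+1.
Hypothesis root_uniq : forall u v, h u = 0 -> h v = 0 -> u = v.
Hypothesis no_cycle : forall c, size c = 2 * k -> ~ ucycle r c.

Lemma height_iter v j : h v <= k -> j <= h v -> h (iter j p v) = h v - j.
Proof.
move=> hv; elim: j => [|j IHj] ltj; first by rewrite subn0.
have {}IHj := IHj (ltnW ltj).
have [|_] := @parentP (iter j p v); rewrite IHj; first by lia.
by rewrite iterS => hj; lia.
Qed.

Lemma height_traject v j z : h v <= k -> j <= (h v).+1 ->
  z \in traject p v j -> exists2 a, a < j & z = iter a p v /\ h z = h v - a.
Proof.
move=> hv lej /trajectP[a ltaj ->]; exists a => //; split=> //.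
by rewrite height_iter //; lia.
Qed.

Lemma uniq_traject_parent v j : h v <= k -> j <= (h v).+1 ->
  uniq (traject p v j).
Proof.
elim: j v => //= j IHj v hv ltj.
have [v0|v0] := posnP (h v); first by have -> : j = 0 by lia.
have [|_ hp] := @parentP v; first by lia.
rewrite IHj; try lia; rewrite andbT.
apply/negP => /height_traject [||a _ []]; lia.
Qed.

Lemma path_traject_parent v j : h v <= k -> j <= h v ->
  path r v (traject p (p v) j).
Proof.
elim: j v => //= j IHj v hv ltj.
have [|rp hp] := @parentP v; first by lia.
by rewrite r_sym rp IHj; lia.
Qed.

(** The path stays at height at least [i] and avoids [x'], while the proper ancestors of its end and
    of [x'] lie below [i]. The two climbs first meet [j] generations up, since the ancestors at
    [j.-1] differ. *)
Lemma close_cycle i j v q x' :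
  i < k -> 0 < j <= i -> path r v q -> uniq (v :: q) -> x' \notin v :: q ->
  (forall z, z \in v :: q -> i <= h z) ->
  size q = (2 * (k - j)).-1 -> h (last v q) = i -> h x' = i -> r x' v ->
  iter j p (last v q) = iter j p x' ->
  iter j.-1 p (last v q) != iter j.-1 p x' -> False.
Proof.
set x := last v q => ltik /andP[j0 leji] pq uq x'q hq szq hx hx' rx' eqj neqj.
(* Path, climb from [p x] to the shared ancestor, descent from just below it to [x']: the length is
   [2 * (k - j) + j + j]. *)
pose c := (v :: q) ++ traject p (p x) j ++ rev (traject p x' j).
apply: (@no_cycle c); first by rewrite /c !size_cat size_rev !size_traject /=; lia.
have hxk : h x <= k by lia.
have hxk' : h x' <= k by lia.
have [|_ hpx] := @parentP x; first by lia.
have hpxk : h (p x) <= k by lia.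
apply/andP; split.
  rewrite /c /= rcons_cat cat_path pq /= rcons_cat cat_path.
  rewrite path_traject_parent //= ?hx //.
  have -> : last x (traject p (p x) j) = iter j p x'.
    by rewrite -eqj last_traject.
  rewrite rcons_path; apply/andP; split.
    (* The descent is the reversed climb from [x']; [belast] drops the shared ancestor, which
       already ends the first climb. *)
    have := @rev_path _ (fun a b => r b a) x' (traject p (p x') j).
    rewrite last_traject => E.
    have eqb : belast x' (traject p (p x') j) = traject p x' j.
      have : rcons (belast x' (traject p (p x') j)) (iter j p x')
        = rcons (traject p x' j) (iter j p x').
        by rewrite -trajectSr trajectS -(last_traject p x' j) -lastI.
      by move/rcons_inj => [].
    rewrite eqb in E.
    rewrite (@eq_path _ _ (fun a b => r b a)); last by move=> a b; rewrite r_sym.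
    by rewrite E path_traject_parent ?hx' // ltnW.
  suff -> : last (iter j p x') (rev (traject p x' j)) = x' by [].
  by case: (j) j0 => // j' _; rewrite trajectS rev_cons last_rcons.
rewrite /c !cat_uniq uq rev_uniq !uniq_traject_parent //=; try lia.
rewrite andbT; apply/andP; split; last first.
  apply/hasPn => z; rewrite mem_rev => /height_traject[||a ltaj [zE hz]]; try lia.
  apply/negP => /height_traject[||b ltbj [zE' hz']]; try lia.
  (* Equal heights mean that the climbs meet after equally many generations. They then agree from
     there on, in particular [j.-1] generations up. *)
  have ab : a = b.+1 by lia.
  move: neqj; rewrite ab in ltaj zE.
  have -> : j.-1 = (j.-1 - b.+1) + b.+1 by lia.
  by rewrite !iterD -zE [iter b.+1 p x]iterSr -zE' eqxx.
apply/hasPn => z; rewrite mem_cat => /orP[].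
  move=> /height_traject[||a ltaj [_ hz]]; try lia.
  by apply/negP => /hq; lia.
rewrite mem_rev => /height_traject[||a ltaj [zE hz]]; try lia.
have [a0|a0] := posnP a; first by rewrite zE a0.
by apply/negP => /hq; lia.
Qed.

(** [w v] is the ancestor common to [N v]. The conditions bear only on nonempty [N v], so vertices
    of another class can be given the empty set. If the bound fails, each of the two layers
    contributes at least the left-hand sum to the total degree, which gives a core of degrees above
    [2 * k]. *)
Lemma fixed_height_density i j (N : T -> {set T}) (w : T -> T) :
  i < k -> 0 < j <= i ->
  (forall v u, h v = i.+1 -> u \in N v -> [/\ h u = i, r u v, iter j p u = w v &
     forall c, 2 * k <= #|[set z in N v | iter j.-1 p z != c]|]) ->
  \sum_(v in [set v | h v == i.+1]) #|N v|
    <= 2 * k * (#|[set v | h v == i]| + #|[set v | h v == i.+1]|).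
Proof.
move=> ltik jP NP; set X := [set v | h v == i]; set Y := [set v | h v == i.+1].
rewrite leqNgt; apply/negP => dense.
pose H u v := (h v == i.+1) && (u \in N v) || (h u == i.+1) && (v \in N u).
have H_sym : symmetric H by move=> u v; rewrite /H orbC.
have HP u v : H u v -> r u v /\ h u + h v = i + i.+1.
  case/orP => /andP[/eqP hv uN]; have [-> ruv _ _] := NP _ _ hv uN; rewrite hv.
    by [].
  by rewrite r_sym ruv addnC.
have XY0 : [disjoint X & Y].
  by apply/pred0P => v /=; rewrite !inE; lia.
have NX v : v \in Y -> N v \subset X.
  rewrite inE => /eqP hv; apply/subsetP => u /(NP _ _ hv)[hu _ _ _].
  by rewrite inE hu.
have degY v : v \in Y -> #|N v| <= deg_in H (X :|: Y) v.
  move=> vY; apply/subset_leq_card/subsetP => u uN.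
  rewrite !inE; have := subsetP (NX v vY) u uN; rewrite inE => -> /=.
  by move: vY; rewrite inE /H => ->; rewrite uN orbT.
have degX : \sum_(v in Y) #|N v| <= \sum_(u in X) deg_in H (X :|: Y) u.
  have -> : \sum_(v in Y) #|N v| = \sum_(v in Y) \sum_(u in X) (u \in N v).
    apply: eq_bigr => v vY; rewrite -sum1_card big_mkcond [RHS]big_mkcond /=.
    apply: eq_bigr => u _; case uN: (u \in N v); last by case: ifP.
    by rewrite (subsetP (NX v vY) u uN).
  rewrite exchange_big /=; apply: leq_sum => u _.
  apply: leq_trans (deg_inS _ _ (subsetUr X Y)); rewrite deg_inE.
  by apply: leq_sum => v; rewrite inE /H => ->; case: (u \in N v).
have [|S [sS S0 core]] := @core_exists _ _ H_sym (fun=> 2 * k) (X :|: Y).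
  have -> : \sum_(v in X :|: Y) deg_in H (X :|: Y) v =
      \sum_(v in X) deg_in H (X :|: Y) v + \sum_(v in Y) deg_in H (X :|: Y) v.
    by rewrite -bigU //=; apply: eq_bigl => v; rewrite !inE.
  rewrite sum_nat_const.
  have degY' : \sum_(v in Y) #|N v| <= \sum_(v in Y) deg_in H (X :|: Y) v.
    exact: leq_sum degY.
  have leXY : #|X :|: Y| <= #|X| + #|Y| by rewrite cardsU leq_subr.
  have := leq_mul (leqnn (2 * k)) leXY; move: dense degX degY'.
  set a := \sum_(v in Y) _; set b := \sum_(v in X) _; set c := \sum_(v in Y) _.
  move: (#|X :|: Y|) => n; set m := 2 * k * (_ + _).
  move: (2 * k) => K; rewrite [n * K]mulnC.
  lia.
have [v vS hv] : exists2 v, v \in S & h v = i.+1.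
  case/set0Pn: S0 => u uS.
  have := subsetP sS _ uS; rewrite !inE => /orP[/eqP hu|/eqP]; last by exists u.
  have /card_gt0P[v] : 0 < deg_in H S u by apply: leq_trans (core u uS); lia.
  by rewrite inE => /andP[vS /HP[_ huv]]; exists v => //; lia.
have [|q [szq pq uq qS]] := @greedy_path _ H S (2 * k) (2 * (k - j)).-1 v core _ vS.
  by lia.
(* Heights alternate between [i] and [i.+1], so a path of odd length changes layer. *)
have parity z s : path H z s ->
    if odd (size s) then h z + h (last z s) = i + i.+1 else h (last z s) = h z.
  elim: s z => //= y s IHs z /andP[/HP[_ hzy] /IHs].
  by case: (odd _) => /=; lia.
(* Invariant along [H]: the ancestor [j] generations above a vertex of layer [i], or [w] of a vertex
   of layer [i.+1]. *)
have anc z s : path H z s ->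
   (if h (last z s) == i then iter j p (last z s) else w (last z s))
     = if h z == i then iter j p z else w z.
  elim: s z => //= y s IHs z /andP[Hzy /IHs ->].
  case/orP: Hzy => /andP[/eqP hy zN]; have [-> _ -> _] := NP _ _ hy zN;
    by rewrite hy eqxx; case: eqP => //; lia.
have hx : h (last v q) = i.
  have := parity _ _ pq; rewrite szq.
  have -> : (2 * (k - j)).-1 = (k - j).-1.*2.+1 by lia.
  by rewrite /= odd_double /=; lia.
have ancx := anc _ _ pq; rewrite hx hv eqxx in ancx.
have {}ancx : iter j p (last v q) = w v by rewrite ancx; case: eqP => //; lia.
have /card_gt0P[u] : 0 < deg_in H S v by apply: leq_trans (core v vS); lia.
rewrite inE => /andP[_ Hvu]; have [_ hu] := HP _ _ Hvu.
have uN : u \in N v.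
  by move: Hvu => /orP[/andP[/eqP]|/andP[]//]; lia.
have [_ _ _ spread] := NP _ _ hv uN.
(* At least [2 * k] candidates have another ancestor than [last v q] at [j.-1], and [q] has fewer
   vertices than that. *)
have [|x'] := @ex_notin_seq _ [set z in N v | iter j.-1 p z != iter j.-1 p (last v q)] q.
  by apply: leq_trans (spread _); rewrite szq; lia.
rewrite inE => /andP[x'N neqx'] x'q; have [hx' rx' ancx' _] := NP _ _ hv x'N.
apply: (@close_cycle i j v q x') => //.
- by apply: sub_path pq => a b /HP[].
- rewrite inE (negPf x'q) orbF; apply/eqP => E.
  by move: hx'; rewrite E hv => /eqP; rewrite eqn_leq ltnn.
- move=> z; rewrite inE => /predU1P[->|/qS zS]; first by rewrite hv.
  by have := subsetP sS _ zS; rewrite !inE => /orP[] /eqP->.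
- by rewrite ancx ancx'.
- by rewrite eq_sym.
Qed.

(** Discarding neighbours costs at most [2 * k ^ 2] per vertex of the upper layer. The rest splits
    into at most [k] classes by the generation [j], each contributing at most
    [2 * k * (#|X| + #|Y|)]. *)
Lemma layer_density i : i < k ->
  \sum_(v in [set v | h v == i.+1]) #|[set u | r u v & h u == i]|
    <= 4 * k ^ 2 * (#|[set v | h v == i]| + #|[set v | h v == i.+1]|).
Proof.
move=> ltik; pose N v := [set u | r u v & h u == i].
set X := [set v | h v == i]; set Y := [set v | h v == i.+1].
(* The triple holds the generation [j], the common ancestor and the kept neighbours. When [N v] is
   small nothing is kept, and the first two entries are dummies. *)
have sel v : exists f : nat * T * {set T},
    [/\ f.2 \subset N v, #|N v| <= #|f.2| + 2 * k ^ 2 &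
     forall u, u \in f.2 -> [/\ 0 < f.1.1 <= i, iter f.1.1 p u = f.1.2 &
       forall c, 2 * k <= #|[set z in f.2 | iter f.1.1.-1 p z != c]|]].
  have [small|big] := leqP #|N v| (2 * k * i + 1).
    exists (0, v, set0); rewrite sub0set cards0; split=> //=.
      by apply: leq_trans small _; nia.
    by move=> u; rewrite inE.
  have cN : {in N v &, forall u u', iter i p u = iter i p u'}.
    move=> u u'; rewrite !inE => /andP[_ /eqP hu] /andP[_ /eqP hu'].
    by apply: root_uniq; rewrite height_iter; lia.
  have [j [N' [jP sN' leN' cN' spread]]] := spread_subset cN big.
  have /set0Pn[u0 u0N'] : N' != set0.
    by apply: contraTneq leN' => ->; rewrite cards0; lia.
  exists (j, iter j p u0, N'); split=> //=.
    by apply: leq_trans leN' _; nia.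
  by move=> u uN'; split=> //; apply: cN'.
have [f fP] := fin_all_exists sel.
have le1 : \sum_(v in Y) #|N v| <= \sum_(v in Y) #|(f v).2| + 2 * k ^ 2 * #|Y|.
  rewrite mulnC -sum_nat_const -big_split /=; apply: leq_sum => v _.
  by have [_] := fP v.
pose Nj j v := if (f v).1.1 == j then (f v).2 else set0.
have le2 : \sum_(v in Y) #|(f v).2| <= \sum_(j < k) \sum_(v in Y) #|Nj j v|.
  rewrite exchange_big /=; apply: leq_sum => v _.
  have [->|/set0Pn[u uf]] := eqVneq (f v).2 set0; first by rewrite cards0.
  have [_ _ /(_ u uf)[jP _ _]] := fP v.
  have ltjk : (f v).1.1 < k by lia.
  by rewrite (bigD1 (Ordinal ltjk)) //= /Nj eqxx leq_addr.
have le3 j : \sum_(v in Y) #|Nj j v| <= 2 * k * (#|X| + #|Y|).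
  have [jP|jP] := boolP (0 < j <= i).
    apply: (@fixed_height_density i j (Nj j) (fun v => (f v).1.2)) => // v u hv.
    rewrite /Nj; case: eqP => [jE|_]; last by rewrite inE.
    move=> uf; have [sf _ /(_ u uf)[_ anc spread]] := fP v.
    have := subsetP sf _ uf; rewrite inE => /andP[ruv /eqP hu].
    by rewrite -jE.
  rewrite big1 // => v _; rewrite /Nj; case: eqP => [jE|_]; last by rewrite cards0.
  apply/eqP; rewrite cards_eq0; apply: contraR jP => /set0Pn[u uf].
  by have [_ _ /(_ u uf)[]] := fP v; rewrite jE.
have le4 : \sum_(j < k) \sum_(v in Y) #|Nj j v| <= k * (2 * k * (#|X| + #|Y|)).
  by rewrite -[X in X * _]card_ord -sum_nat_const; apply: leq_sum.
apply: leq_trans le1 _; apply: leq_trans (leq_add (leq_trans le2 le4) (leqnn _)) _.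
nia.
Qed.

End LayerDensity.

(** * Growth of the layers inside a bipartite core *)

Section Growth.
Variables (T : finType) (r : rel T) (s : T -> bool) (k : nat).
Variables (t : bool -> nat) (S : {set T}).
Hypothesis r_sym : symmetric r.
Hypothesis r_bip : forall u v, r u v -> s v = ~~ s u.
Hypothesis no_cycle : forall c, size c = 2 * k -> ~ ucycle r c.
Hypothesis k_gt0 : 0 < k.
Hypothesis core : forall v, v \in S -> t (s v) < deg_in r S v.
Hypothesis t_large : forall b, 24 * k ^ 2 <= t b.

Let rS u v := [&& r u v, u \in S & v \in S].

(** Layer [i] lies on side [s x (+) odd i], and passing to the next layer multiplies its size by at
    least [t / (8 * k ^ 2)] for the threshold [t] of that side. *)
Lemma core_growth x : x \in S ->
  \prod_(i < k) t (s x (+) odd i)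
    <= (8 * k ^ 2) ^ k * #|[set v in S | s v == s x (+) odd k]|.
Proof.
(* Truncating at [k.+1] keeps heights up to [k] exact; all farther vertices get [k.+1]. *)
move=> xS; set h := tdist rS x k.+1.
have rS_sym : symmetric rS by move=> u v; rewrite /rS r_sym; do 2!case: (_ \in S).
have [p parentP] : exists p : T -> T,
    forall v, 0 < h v <= k -> rS (p v) v /\ h v = (h (p v)).+1.
  apply: (@fin_all_exists _ (fun=> T)
            (fun v u => 0 < h v <= k -> rS u v /\ h v = (h u).+1)) => v.
  have [hv|] := boolP (0 < h v <= k); last by exists v.
  by have [u ruv huv] := tdist_parent hv; exists u.
have root v : h v = 0 -> v = x by apply: tdist_eq0.
have layerP i v : i <= k -> h v = i -> v \in S /\ s v = s x (+) odd i.
  elim: i v => [|i IHi] v leik hv; first by rewrite (root v hv) addbF.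
  have [|rp hp] := parentP v; first by rewrite hv.
  have [|_ sp] := IHi (p v) (ltnW leik); first by move: hp; rewrite hv => -[].
  case/and3P: rp => /r_bip -> _ ->; split=> //.
  by rewrite sp /= addbN.
pose n i := #|[set v | h v == i]|.
pose e i := \sum_(v in [set v | h v == i.+1]) #|[set u | rS u v & h u == i]|.
have e_le i : i < k -> e i <= 4 * k ^ 2 * (n i + n i.+1).
  apply: (@layer_density T rS h p) => // [u v /root-> /root->//|c szc].
  case/andP=> cc uc; apply: (no_cycle szc); rewrite /ucycle uc andbT.
  by apply: sub_cycle cc => u v /andP[].
(* The same edges, counted from the lower layer. *)
have eE i : e i = \sum_(u in [set u | h u == i]) #|[set v | rS u v & h v == i.+1]|.
  pose F u v := (rS u v && (h u == i) && (h v == i.+1) : nat).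
  transitivity (\sum_v \sum_u F u v).
    rewrite /e big_mkcond; apply: eq_bigr => v _; rewrite inE.
    case: ifP => hv; last by rewrite big1 // => u _; rewrite /F hv andbF.
    rewrite -sum1_card big_mkcond; apply: eq_bigr => u _.
    by rewrite inE /F hv andbT; case: (_ && _).
  rewrite exchange_big [RHS]big_mkcond; apply: eq_bigr => u _; rewrite inE.
  case: ifP => hu; last by rewrite big1 // => v _; rewrite /F hu andbF.
  rewrite -sum1_card [RHS]big_mkcond; apply: eq_bigr => v _.
  by rewrite inE /F hu andbT; case: (_ && _).
have n0 : n 0 = 1.
  rewrite /n (_ : [set v | h v == 0] = [set x]) ?cards1 //.
  apply/setP => v; rewrite !inE; apply/eqP/eqP => [/root//|->].
  exact: tdist_root.
(* Monotonicity is carried along to absorb the layer below in the next step. *)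
have grow i : i < k ->
    n i <= n i.+1 /\ t (s x (+) odd i) * n i <= 8 * k ^ 2 * n i.+1.
  have k2 : 0 < k ^ 2 by rewrite expn_gt0 k_gt0.
  elim: i => [|i IHi] ltik.
    rewrite n0 addbF muln1.
    have : t (s x) <= n 1.
      apply: leq_trans (ltnW (core xS)) _; apply/subset_leq_card/subsetP => v.
      rewrite !inE => /andP[vS rxv].
      have /= := @tdist_adj _ rS x k.+1 x v; rewrite /rS rxv xS vS => /(_ isT).
      rewrite tdist_root -/(h v) => hv.
      suff : h v != 0 by lia.
      apply: contraTneq rxv => /root ->; apply/negP => /r_bip.
      by case: (s x).
    have := t_large (s x); nia.
  have [nle nt] := IHi (ltnW ltik).
  have tn : t (s x (+) odd i.+1) * n i.+1 <= e i + e i.+1.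
    rewrite (eE i.+1) /e -big_split /= mulnC /n -sum_nat_const; apply: leq_sum => v.
    rewrite inE => /eqP hv; have [vS sv] := layerP _ _ (ltnW ltik) hv.
    rewrite -sv; apply: leq_trans (ltnW (core vS)) _.
    apply: leq_trans (leq_card_setU _ _); apply/subset_leq_card/subsetP => u.
    rewrite !inE => /andP[uS rvu].
    have rSvu : rS v u by rewrite /rS rvu vS uS.
    have := @tdist_adj _ rS x k.+1 _ _ rSvu; rewrite -/(h u) -/(h v) => huv.
    have := rSvu; rewrite rS_sym => /(@tdist_adj _ rS x k.+1).
    rewrite -/(h u) -/(h v) => hvu.
    rewrite -[rS u v]rS_sym rSvu /=.
    (* Adjacent heights differ by at most one, and equal heights would put both ends on the same
       side. So all core neighbours of [v] lie in layers [i] and [i.+2]. *)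
    suff : h u != h v by lia.
    apply/eqP => huv'.
    have [_ su] := layerP _ u (ltnW ltik) (etrans huv' hv).
    by have := r_bip rvu; rewrite su sv; case: (_ (+) _).
  have := e_le i (ltnW ltik); have := e_le i.+1 ltik.
  have := t_large (s x (+) odd i.+1); move: tn nle k2.
  move: (t _) (n i) (n i.+1) (n i.+2) (e i) (e i.+1) (k ^ 2).
  clear => t n0 n1 n2 e0 e1 c tn n01 c0 tc e1b e0b.
  (* The layer bounds and [n0 <= n1] give [12 * c * n1 + 4 * c * n2]. As [24 * c <= t], the first
     term is at most half of [t * n1], whence [t * n1 <= 8 * c * n2] and [3 * n1 <= n2]. *)
  have tn' : 24 * c * n1 <= t * n1 by rewrite leq_mul2r tc orbT.
  have main : t * n1 <= 12 * c * n1 + 4 * c * n2 by nia.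
  have main' : t * n1 <= 8 * c * n2 by nia.
  split=> //; have : 8 * c * (3 * n1) <= 8 * c * n2 by nia.
  by rewrite leq_pmul2l; lia.
have prod m : m <= k ->
    \prod_(i < m) t (s x (+) odd i) <= (8 * k ^ 2) ^ m * n m.
  elim: m => [|m IHm] lemk; first by rewrite big_ord0 n0.
  have [_] := grow m lemk; move: (IHm (ltnW lemk)); rewrite big_ord_recr /=.
  move: (8 * k ^ 2) => D leP leD; apply: leq_trans (leq_mul leP (leqnn _)) _.
  by rewrite -mulnA expnSr -mulnA leq_mul2l [n m * _]mulnC leD orbT.
apply: leq_trans (prod k (leqnn k)) _; rewrite leq_mul2l; apply/orP; right.
apply/subset_leq_card/subsetP => v; rewrite !inE => /eqP hv.
by have [-> ->] := layerP k v (leqnn k) hv; rewrite eqxx.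
Qed.

(** Take adjacent roots [x] and [y]. At every [i] their factors are [t true] and [t false] in some
    order, and their [k]-th layers lie on opposite sides. *)
Lemma core_product_bound : S != set0 ->
  (t true * t false) ^ k
    <= (8 * k ^ 2) ^ (2 * k) * (#|[set v in S | s v]| * #|[set v in S | ~~ s v]|).
Proof.
case/set0Pn => x xS.
have [y yS sy] : exists2 y, y \in S & s y = ~~ s x.
  have /card_gt0P[y] : 0 < deg_in r S x by apply: leq_trans (core xS).
  by rewrite inE => /andP[yS /r_bip]; exists y.
have := leq_mul (core_growth xS) (core_growth yS).
rewrite -big_split /= (eq_bigr (fun=> t true * t false)); last first.
  move=> i _; rewrite sy; case: (s x); case: (odd i) => //=; exact: mulnC.
rewrite prod_nat_const card_ord mulnACA -expnD addnn -mul2n => le.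
apply: leq_trans le _; rewrite leq_mul2l; apply/orP; right.
have E b : #|[set v in S | s v == b]| =
    #|[set v in S | if b then s v else ~~ s v]|.
  by apply: eq_card => v; rewrite !inE; case: b; case: (s v).
by rewrite sy !E; case: (s x); case: (odd k); rewrite //= mulnC.
Qed.

End Growth.

(** * Random cuts and the edge bound in natural numbers *)

Lemma card_separating (T : finType) (a b : T) : a != b ->
  2 ^ #|T| <= 4 * #|[set S : {set T} | (a \in S) && (b \notin S)]|.
Proof.
move=> neq_ab; set U := ~: [set a; b].
have -> : 2 ^ #|T| = 4 * #|powerset U|.
  by rewrite card_powerset -(cardsC [set a; b]) cards2 neq_ab expnD.
(* Adding [a] maps the subsets of [U] injectively to sets containing [a] but not [b]. *)
rewrite leq_mul2l /= -(card_in_imset (f := fun X => a |: X)).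
  apply/subset_leq_card/subsetP => S /imsetP[X].
  rewrite powersetE => /subsetP sXU ->; rewrite !inE eqxx /= negb_or eq_sym neq_ab /=.
  by apply/negP => /sXU; rewrite !inE eqxx orbT.
move=> X Y; rewrite !powersetE => /subsetP sX /subsetP sY eqXY.
have aX : a \notin X by apply/negP => /sX; rewrite !inE eqxx.
have aY : a \notin Y by apply/negP => /sY; rewrite !inE eqxx.
by rewrite -(setU1K aX) eqXY setU1K.
Qed.

Section EdgesBetween.
Variable G : sgraph.
Implicit Types A B : {set G}.

Lemma edges_betweenE A B :
  edges_between A B = \sum_(a in A) \sum_(b in B) adj a b.
Proof.
rewrite /edges_between -sum1_card pair_big /= big_mkcond [RHS]big_mkcond /=.
by apply: eq_bigr => -[a b] _; rewrite !inE /=; case: (a \in A); case: (b \in B); case: (adj a b).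
Qed.

(** Average over all [S]: a given pair [(a, b)] of adjacent vertices has [a] in [S] and [b] outside
    for at least a quarter of the sets. *)
Lemma quarter_cut A B : exists S : {set G},
  edges_between A B <= 4 * edges_between (A :&: S) (B :\: S).
Proof.
case: (boolP [exists S : {set G},
  edges_between A B <= 4 * edges_between (A :&: S) (B :\: S)]) => [/existsP//|].
move/existsPn => small; exfalso.
set E := [set p in setX A B | adj p.1 p.2].
have eS S : edges_between (A :&: S) (B :\: S)
    = \sum_(p in E) ((p.1 \in S) && (p.2 \notin S)).
  rewrite /edges_between -sum1_card big_mkcond [RHS]big_mkcond /=.
  apply: eq_bigr => p _; rewrite !inE.
  by case: (_ \in A); case: (_ \in S); case: (_ \in S); case: (_ \in B);
     case: (adj _ _).
have : \sum_(S : {set G}) 4 * edges_between (A :&: S) (B :\: S)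
    < \sum_(S : {set G}) edges_between A B.
  rewrite (bigD1 set0) //= [ltnRHS](bigD1 set0) //= -addSn.
  apply: leq_add; first by have := small set0; rewrite -ltnNge.
  by apply: leq_sum => S _; have := small S; rewrite -ltnNge => /ltnW.
rewrite ltnNge => /negP; apply.
rewrite sum_nat_const -[#|_|]cardsT.
have -> : #|[set: {set G}]| = 2 ^ #|G|.
  by rewrite -cardsT -card_powerset; apply: eq_card => S; rewrite !inE subsetT.
rewrite -big_distrr /= (eq_bigr _ (fun S _ => eS S)) exchange_big big_distrr /=.
rewrite {1}/edges_between -/E mulnC -sum_nat_const; apply: leq_sum => -[a b].
rewrite !inE /= => /andP[_ adjab].
have neq_ab : a != b by apply: contraTneq adjab => ->; rewrite adj_irrefl.
apply: leq_trans (card_separating neq_ab) _; rewrite leq_mul2l /= -sum1_card.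
rewrite big_mkcond; apply: leq_sum => S _; rewrite inE; by case: (_ && _).
Qed.

(** With thresholds [e / (3 * #|A|)] and [e / (3 * #|B|)], twice their sum is at most [4 * e / 3],
    below the degree sum [2 * e]. The factor 72 makes both at least [24 * k ^ 2]. *)
Lemma disjoint_edge_bound k A B : 1 < k -> ~ has_cycle G (2 * k) ->
  [disjoint A & B] -> 72 * k ^ 2 * (#|A| + #|B|) < edges_between A B ->
  edges_between A B ^ (2 * k) <= (48 * k ^ 2) ^ (2 * k) * (#|A| * #|B|) ^ k.+1.
Proof.
move=> k1 noC disAB; set e := edges_between A B => large.
have k0 : 0 < k by apply: ltn_trans k1.
have k2 : 0 < k ^ 2 by rewrite expn_gt0 k0.
have notAB v : v \in A -> v \in B -> False.
  by move=> vA vB; move/pred0P: disAB => /(_ v) /=; rewrite vA vB.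
have A0 : 0 < #|A|.
  rewrite card_gt0; apply: contraTneq large => A0.
  by rewrite /e edges_betweenE A0 big_set0.
have B0 : 0 < #|B|.
  rewrite card_gt0; apply: contraTneq large => B0.
  by rewrite /e edges_betweenE B0 big1 // => a _; rewrite big_set0.
(* Only edges across are kept; as [A] and [B] are disjoint, membership in [A] is a proper
   2-colouring. *)
pose r u v := adj u v && ((u \in A) && (v \in B) || (u \in B) && (v \in A)).
pose s v := v \in A.
pose t (b : bool) := if b then e %/ (3 * #|A|) else e %/ (3 * #|B|).
have r_sym : symmetric r.
  by move=> u v; rewrite /r adj_sym orbC andbC [(v \in A) && _]andbC
    [(v \in B) && _]andbC andbC.
have r_bip u v : r u v -> s v = ~~ s u.
  rewrite /r /s => /andP[_ /orP[]/andP[uA vB]].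
    by rewrite uA; case: (boolP (v \in A)) => // /notAB/(_ vB).
  by rewrite vB; case: (boolP (u \in A)) => // /notAB/(_ uA).
have no_cyc c : size c = 2 * k -> ~ ucycle r c.
  move=> szc /andP[cc uc]; apply: noC; exists c; split=> //.
  by rewrite /ucycle uc andbT; apply: sub_cycle cc => u v /andP[].
have t_large b : 24 * k ^ 2 <= t b.
  by rewrite /t; case: b; rewrite leq_divRL ?muln_gt0 //; nia.
have splitU (F : G -> nat) :
    \sum_(v in A :|: B) F v = \sum_(v in A) F v + \sum_(v in B) F v.
  by rewrite -bigU //=; apply: eq_bigl => v; rewrite !inE.
have [|S [sS S0 core]] := @core_exists _ _ r_sym (fun v => t (s v)) (A :|: B).
  have leA : e <= \sum_(v in A) deg_in r (A :|: B) v.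
    rewrite /e edges_betweenE; apply: leq_sum => a aA.
    apply: leq_trans (deg_inS _ _ (subsetUr A B)); rewrite deg_inE.
    by apply: leq_sum => b bB; rewrite /r aA bB /= andbT.
  have leB : e <= \sum_(v in B) deg_in r (A :|: B) v.
    rewrite /e edges_betweenE exchange_big; apply: leq_sum => b bB.
    apply: leq_trans (deg_inS _ _ (subsetUl A B)); rewrite deg_inE.
    by apply: leq_sum => a aA; rewrite /r aA bB adj_sym /= orbT andbT.
  rewrite !splitU (eq_bigr (fun=> t true)); last by move=> v vA; rewrite /s vA.
  rewrite sum_nat_const (eq_bigr (fun=> t false)); last first.
    by move=> v vB; rewrite /s; case: (boolP (v \in A)) => // /notAB/(_ vB).
  rewrite sum_nat_const /t.
  have := leq_trunc_div e (3 * #|A|); have := leq_trunc_div e (3 * #|B|).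
  by lia.
have := core_product_bound r_sym r_bip no_cyc k0 core t_large S0.
set SA := [set v in S | s v]; set SB := [set v in S | ~~ s v] => bound.
have leSA : #|SA| <= #|A|.
  by apply/subset_leq_card/subsetP => v; rewrite inE => /andP[].
have leSB : #|SB| <= #|B|.
  apply/subset_leq_card/subsetP => v; rewrite inE => /andP[/(subsetP sS)].
  by rewrite inE /s => /orP[->|].
(* Once the quotient is positive, rounding down loses at most a factor 2. *)
have half_div n : 0 < n -> 0 < e %/ (3 * n) -> e <= 6 * n * (e %/ (3 * n)).
  move=> n0 q0; have := ltn_ceil e (_ : 0 < 3 * n); rewrite muln_gt0 n0 => /(_ isT).
  by move: q0; move: (_ %/ _) => q; nia.
have leA : e <= 6 * #|A| * t true.
  by apply: half_div; rewrite // (leq_trans _ (t_large true)) // muln_gt0.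
have leB : e <= 6 * #|B| * t false.
  by apply: half_div; rewrite // (leq_trans _ (t_large false)) // muln_gt0.
have e2 : e ^ 2 <= 6 ^ 2 * (#|A| * #|B|) * (t true * t false).
  rewrite -mulnn; apply: leq_trans (leq_mul leA leB) _.
  by rewrite leq_eqVlt; apply/orP; left; apply/eqP; nia.
rewrite expnM; apply: leq_trans (_ : _ <= (6 ^ 2 * (#|A| * #|B|) * (t true * t false)) ^ k) _.
  by rewrite leq_exp2r.
rewrite expnMn; apply: leq_trans (leq_mul (leqnn _) bound) _.
apply: leq_trans (leq_mul (leqnn _) (leq_mul (leqnn _) (leq_mul leSA leSB))) _.
have -> : 48 * k ^ 2 = 6 * (8 * k ^ 2) by rewrite mulnA.
move: (8 * k ^ 2) (#|A| * #|B|) => D q.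
by rewrite [(6 ^ 2 * q) ^ k]expnMn -expnM [(6 * D) ^ _]expnMn expnSr mulnACA.
Qed.

End EdgesBetween.

(** The cut makes [A] and [B] disjoint at the cost of a factor 4: [288 = 4 * 72] and
    [192 = 4 * 48]. *)
Lemma edge_bound (G : sgraph) k (A B : {set G}) : 1 < k ->
  ~ has_cycle G (2 * k) ->
  edges_between A B <= 288 * k ^ 2 * (#|A| + #|B|) \/
  edges_between A B ^ (2 * k) <= (192 * k ^ 2) ^ (2 * k) * (#|A| * #|B|) ^ k.+1.
Proof.
move=> k1 noC; have [S cut] := quarter_cut A B.
have leA : #|A :&: S| <= #|A| by rewrite subset_leq_card ?subsetIl.
have leB : #|B :\: S| <= #|B| by rewrite subset_leq_card ?subsetDl.
have dis : [disjoint A :&: S & B :\: S].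
  by apply/pred0P => v; rewrite /= !inE; case: (v \in S); rewrite ?andbF.
have [small|large] :=
    leqP (edges_between (A :&: S) (B :\: S)) (72 * k ^ 2 * (#|A :&: S| + #|B :\: S|)).
  left; have := leq_mul (leqnn (72 * k ^ 2)) (leq_add leA leB).
  by move: cut small; move: (edges_between _ _) (edges_between _ _) (k ^ 2); lia.
right; have := disjoint_edge_bound k1 noC dis large.
have -> : 192 * k ^ 2 = 4 * (48 * k ^ 2) by rewrite mulnA.
move: cut; move: (edges_between _ _) (edges_between _ _) => e' e cut bound.
have le : e ^ (2 * k) <= (4 * e') ^ (2 * k) by rewrite leq_exp2r ?muln_gt0 ?(ltnW k1).
apply: leq_trans le _; move: bound; move: (48 * k ^ 2) => D bound.
rewrite (expnMn 4 e') (expnMn 4 D) -mulnA leq_mul2l; apply/orP; right.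
apply: leq_trans bound _; rewrite leq_mul2l; apply/orP; right.
by rewrite leq_exp2r // leq_mul.
Qed.

(** * The bound over the reals *)

Import Order.TTheory GRing.Theory Num.Theory.
Local Open Scope ring_scope.

Theorem corollary2p2 (R : realType) (k : nat) (hk : (2 <= k)%N) :
  exists C : R, 0 < C /\
    forall (G : sgraph) (A B : {set G}),
      ~ has_cycle G (2 * k)%N ->
      (edges_between A B)%:R <=
        C * (#|A|%:R + #|B|%:R
             + powR (#|A|%:R * #|B|%:R) ((k%:R + 1) / (2 * k%:R))).
Proof.
have k0 : (0 < k)%N by apply: ltn_trans hk.
have C0 : (0 < 288 * k ^ 2)%N by rewrite muln_gt0 expn_gt0 k0.
(* The larger of the constants in the two alternatives. *)
exists (288 * k ^ 2)%:R; split; first by rewrite ltr0n.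
move=> G A B noC; set y := powR _ _.
have y0 : 0 <= y by apply: powR_ge0.
rewrite mulrDr; have [small|large] := edge_bound A B hk noC.
  apply: (@le_trans _ _ ((288 * k ^ 2)%:R * (#|A|%:R + #|B|%:R))).
    by rewrite -natrD -natrM ler_nat.
  by rewrite lerDl mulr_ge0.
apply: (@le_trans _ _ ((192 * k ^ 2)%:R * y)); last first.
  apply: (@le_trans _ _ ((288 * k ^ 2)%:R * y)).
    by rewrite ler_wpM2r // ler_nat leq_mul2r orbT.
  by rewrite lerDr mulr_ge0 // addr_ge0.
(* Raising to the power [2 * k] clears the denominator of the exponent and reduces the claim to
   natural numbers. *)
have yX : y ^+ (2 * k) = (#|A| * #|B|)%:R ^+ k.+1.
  have kR : 2 * k%:R != 0 :> R by rewrite mulf_neq0 ?pnatr_eq0 // -lt0n.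
  rewrite -powR_mulrn // /y -powRrM natrM divfK // natr1 -natrM.
  by rewrite powR_mulrn.
rewrite -(@ler_pXn2r _ (2 * k)) ?nnegrE ?muln_gt0 ?mulr_ge0 //.
by rewrite exprMn yX -!natrX -natrM ler_nat.
Qed.
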